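(* Let $\alpha\in[0,1]$ and let $\tau$ be the (random) time at which the controller stops. Suppose that the plausible-world set $\mathcal{W}_\tau$ at the stopping time satisfies $\mathbb{P}(\omega_\tau^\star\in\mathcal{W}_\tau)\ge 1-\alpha$, and that the controller commits only to actions $a$ with $\mathcal{U}_\tau(a)=\emptyset$. Let $a_\tau$ denote the action committed at time $\tau$. Then $$\mathbb{P}\bigl(a_\tau\notin\Gamma_\tau(\omega_\tau^\star)\bigr)\le\alpha ,$$ where $\{a_\tau\notin\Gamma_\tau(\omega_\tau^\star)\}$ denotes the event that the controller commits to an action $a_\tau$ and this action is not safely admissible in the true world $\omega_\tau^\star$.
   Context: All random objects live on a common probability space, and all events mentioned are assumed measurable. At each decision step $t$ there are: a set $\mathcal{A}_t$ of candidate actions; a latent world space $\Omega_t$; a true world $\omega_t^\star\in\Omega_t$ (random); a plausible-world set $\mathcal{W}_t\subseteq\Omega_t$ (random, computed from the agent's history); and, for each world $\omega\in\Omega_t$, a set $\Gamma_t(\omega)\subseteq\mathcal{A}_t$ of actions that are safely admissible in $\omega$. For $a\in\mathcal{A}_t$ the uncertified region is $$\mathcal{U}_t(a)=\{\omega\in\mathcal{W}_t: a\notin\Gamma_t(\omega)\}.$$ At the stopping time $\tau$ the controller either commits to some action $a_\tau\in\mathcal{A}_\tau$ or returns a fallback (defer, escalate, abstain), in which case no action is committed. Objects with subscript $\tau$ are those of the (random) step $\tau$. *)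

(* Defs.v *)
From HB Require Import structures.
From mathcomp Require Import all_boot all_order all_algebra.
From mathcomp Require Import all_classical all_reals all_analysis.

Set Implicit Arguments.
Unset Strict Implicit.
Unset Printing Implicit Defensive.

Local Open Scope classical_set_scope.

(* The action set and the latent world space of step t are the types [A t] and
   [Om t], [Gamma t w] is the set of actions safely admissible in the world [w],
   and random objects are functions of the sample point [x : T]. *)

Definition uncertified (Om A : Type) (Gamma : Om -> set A) (W : set Om) (a : A)
    : set Om :=
  [set w | W w /\ ~ Gamma w a].

Definition true_world_plausible (T : Type) (Om : nat -> Type)
    (omega_star : forall t, T -> Om t) (W : forall t, T -> set (Om t))
    (tau : T -> nat) : set T :=
  [set x | W (tau x) x (omega_star (tau x) x)].

(* [act x] is the output of the controller at the stopping time: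
   [Some a] when it commits to the action [a], [None] when it returns a fallback
   (defer, escalate, abstain). *)

Definition commits_only_certified (T : Type) (Om A : nat -> Type)
    (Gamma : forall t, Om t -> set (A t)) (W : forall t, T -> set (Om t))
    (tau : T -> nat) (act : forall x : T, option (A (tau x))) : Prop :=
  forall (x : T) (a : A (tau x)),
    act x = Some a -> uncertified (@Gamma (tau x)) (W (tau x) x) a = set0.

Definition unsafe_commitment (T : Type) (Om A : nat -> Type)
    (Gamma : forall t, Om t -> set (A t)) (omega_star : forall t, T -> Om t)
    (tau : T -> nat) (act : forall x : T, option (A (tau x))) : set T :=
  [set x | exists a : A (tau x),
     act x = Some a /\ ~ Gamma (tau x) (omega_star (tau x) x) a].

(* Main.v *)
Require Import Defs.
From HB Require Import structures.
From mathcomp Require Import all_boot all_order all_algebra.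
From mathcomp Require Import all_classical all_reals all_analysis.

Set Implicit Arguments.
Unset Strict Implicit.
Unset Printing Implicit Defensive.

Local Open Scope classical_set_scope.
Local Open Scope ring_scope.

(** An action with empty uncertified region is safe in every plausible world at once, so an unsafe
    commitment can occur only where the true world has escaped the plausible set.
    [unsafe_commitment_sub_uncovered] is this inclusion of events. It is argued at each sample point
    [x] with its own step [tau x], so the random stopping time costs no union bound over steps.
    Monotonicity of [P] and the coverage bound then conclude. *)

Lemma unsafe_commitment_sub_uncovered (T : Type) (Om A : nat -> Type)
    (Gamma : forall t, Om t -> set (A t)) (omega_star : forall t, T -> Om t)
    (W : forall t, T -> set (Om t)) (tau : T -> nat)
    (act : forall x : T, option (A (tau x))) :
  commits_only_certified Gamma W act ->
  unsafe_commitment Gamma omega_star act `<=`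
    ~` true_world_plausible omega_star W tau.
Proof.
move=> certified x [a [actx unsafe]] plausible.
(* The true world itself would be a point of the region that certification makes empty. *)
have : uncertified (@Gamma (tau x)) (W (tau x) x) a (omega_star (tau x) x) by split.
by rewrite (certified x a actx).
Qed.

Theorem proposition1 (R : realType) (d : measure_display)
    (T : measurableType d) (P : probability T R)
    (A Om : nat -> Type)
    (Gamma : forall t : nat, Om t -> set (A t))
    (omega_star : forall t : nat, T -> Om t)
    (W : forall t : nat, T -> set (Om t))
    (tau : {RV P >-> nat})
    (act : forall x : T, option (A (tau x)))
    (alpha : R)
    (alpha_ge0 : 0 <= alpha) (alpha_le1 : alpha <= 1)
    (mcover : measurable (true_world_plausible omega_star W tau))
    (munsafe : measurable (unsafe_commitment Gamma omega_star act))
    (cover : ((1 - alpha)%:E <= P (true_world_plausible omega_star W tau))%E)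
    (certified : commits_only_certified Gamma W act) :
  (P (unsafe_commitment Gamma omega_star act) <= alpha%:E)%E.
Proof.
apply: (@Order.POrderTheory.le_trans _ _ (P (~` true_world_plausible omega_star W tau))).
  apply: le_measure; rewrite ?inE //; first exact: measurableC.
  exact: unsafe_commitment_sub_uncovered.
(* Terms move across an extended-real inequality only when finite, as [P] of an event and [alpha%:E]
   are; swapping them turns the goal into [cover]. *)
rewrite probability_setC // leeBlDr //; last exact: fin_num_measure.
by rewrite addeC -leeBlDr.
Qed.
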